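(* Let $T>0$ and $0<a<\infty$, let $\varphi:\mathbb{R}\to(-a,a)$ be a homeomorphism with $\varphi(0)=0$, and let $f:[0,T]\times\mathbb{R}\times\mathbb{R}\to\mathbb{R}$ be continuous. Assume that there exist $h\in C([0,T],\mathbb{R}^{+})$ and $n\in C^{1}(\mathbb{R},\mathbb{R})$ such that \[ \|h\|_{L^{1}}<\frac a2,\qquad n(0)=0,\qquad \varphi(y)\,n'(x)\,y\ge 0\quad\text{for all }x,y\in\mathbb{R}, \] and \[ |f(t,x,y)|\le f(t,x,y)\,n(x)+h(t)\quad\text{for all }(t,x,y)\in[0,T]\times\mathbb{R}\times\mathbb{R}. \] Then the Dirichlet problem \[ (\varphi(u'))'=f(t,u,u'),\qquad u(0)=0=u(T), \] has at least one solution.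
   Context: Here $\mathbb{R}^{+}=[0,\infty)$ and $\|h\|_{L^{1}}=\int_0^T|h(t)|\,dt$. A solution of the Dirichlet problem is a function $u:[0,T]\to\mathbb{R}$ of class $C^{1}$ such that $\varphi(u')$ is continuously differentiable, $(\varphi(u'(t)))'=f(t,u(t),u'(t))$ for all $t\in[0,T]$, and $u(0)=0=u(T)$. *)

(* Defs.v *)
From HB Require Import structures.
From mathcomp Require Export all_boot all_order all_algebra.
From mathcomp Require Export all_classical all_reals all_analysis.

Set Implicit Arguments.
Unset Strict Implicit.
Unset Printing Implicit Defensive.

Export Order.TTheory GRing.Theory Num.Theory.
Export numFieldNormedType.Exports.

Local Open Scope classical_set_scope.
Local Open Scope ring_scope.

(* Since [f] maps into [B], continuity of [f] as a map to [Y] or to the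
   subspace [B] is the same; the inverse is only required to be continuous
   for the subspace topology of [B]. *)
Definition homeomorphism_onto (X Y : topologicalType) (f : X -> Y)
    (B : set Y) : Prop :=
  [/\ set_bij setT B f, continuous f &
      exists g : Y -> X, cancel f g /\ {within B, continuous g}].

(* Functions on an interval [A] are represented by total functions whose
   values outside [A] are irrelevant. The difference quotient is therefore
   taken along points of [A] only, which gives the one-sided derivatives at
   the endpoints of [A] belonging to it. *)
Definition diff_quot (R : realType) (g : R -> R) (t s : R) : R :=
  (g s - g t) / (s - t).

Definition derivable_in (R : realType) (A : set R) (g : R -> R) (t : R) : Prop :=
  cvg (diff_quot g t @ within A t^').

(* Meaningful only when [derivable_in A g t] holds. *)
Definition derive_in (R : realType) (A : set R) (g : R -> R) (t : R) : R :=
  lim (diff_quot g t @ within A t^').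

Definition C1_in (R : realType) (A : set R) (g : R -> R) : Prop :=
  (forall t, A t -> derivable_in A g t) /\
  {within A, continuous (derive_in A g)}.

Definition dirichlet_solution (R : realType) (T : R) (phi : R -> R)
    (f : R -> R -> R -> R) (u : R -> R) : Prop :=
  let I := [set` `[0, T]] in
  let du := derive_in I u in
  [/\ C1_in I u,
      C1_in I (phi \o du),
      forall t, I t -> derive_in I (phi \o du) t = f t (u t) (du t) &
      u 0 = 0 /\ u T = 0].

(* Main.v *)
(* Put w = phi (u'), so that u' = g(w), w' = f(t, u, g(w)), where g is the
   inverse of phi, frozen outside [-a/2, a/2]. The field is then bounded: g is
   bounded by some M, hence u stays in [-MT, MT]. The Euler scheme from u = 0,
   w = w0 depends continuously on w0 and its final position has the sign of w0
   (or of -w0) for large |w0|, so for each step size some w0 brings u back to 0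
   at time T. As the schemes are uniformly Lipschitz, their pointwise limit along
   an ultrafilter solves the system. Finally w n(u) + H, with H' = h, increases
   at least as fast as |w'|, vanishes at 0 and equals ||h|| at T, while w
   vanishes somewhere by Rolle's theorem; so |w| <= ||h|| < a/2, where g is the
   true inverse of phi. *)
Require Import Defs.
From mathcomp Require Import ring lra.

Set Implicit Arguments.
Unset Strict Implicit.
Local Open Scope classical_set_scope.
Local Open Scope ring_scope.

(** * Limits along an ultrafilter *)

Lemma ultra_bounded_cvg (R : realType) (I : Type) (U : set_system I)
    (u : I -> R) (C : R) :
  UltraFilter U -> (forall i, `|u i| <= C) -> cvg (u @ U).
Proof.
move=> UU uC.
have UF : ProperFilter U by exact: ultra_proper.
have UC : (u @ U) [set` `[- C, C]].
  apply: (@filterS _ U _ setT) filterT => i _ /=.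
  by rewrite in_itv /= -ler_norml.
have [p [_ clp]] := @segment_compact R (- C) C (u @ U) _ UC.
apply/cvg_ex; exists p => V pV.
(* An ultrafilter converges to each of its cluster points: it contains the preimage of [V] or of its
   complement, and [p] clusters only with the former. *)
have [//|nV] := in_ultra_setVsetC (u @^-1` V) UU.
by have [x [nVx Vx]] := clp (~` V) V nV pV.
Qed.

(** * Increment estimates for recursions with a fixed step size *)

Section euler_steps.
Context {R : realType}.
Implicit Types (z c : nat -> R) (d l e r s t : R).

Lemma step_sum_approx z c d l e (i m : nat) : 0 <= d ->
  (forall k, z k.+1 = z k + d * c k) ->
  (forall k, (i <= k < i + m)%N -> `|c k - l| <= e) ->
  `|z (i + m)%N - z i - d * m%:R * l| <= d * m%:R * e.
Proof.
move=> d0 zS; elim: m => [|m IH] cl.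
  by rewrite addn0 subrr mulr0 !mul0r subrr normr0.
rewrite addnS zS.
have -> : z (i + m)%N + d * c (i + m)%N - z i - d * m.+1%:R * l =
  (z (i + m)%N - z i - d * m%:R * l) + d * (c (i + m)%N - l).
  by rewrite -natr1; ring.
apply: (le_trans (ler_normD _ _)).
have -> : d * m.+1%:R * e = d * m%:R * e + d * e by rewrite -natr1; ring.
apply: lerD.
- by apply: IH => k /andP[ik km]; apply: cl; rewrite ik addnS ltnS ltnW.
- by rewrite normrM ger0_norm// ler_wpM2l// cl// leq_addr addnS ltnS/=.
Qed.

Lemma step_lipschitz z c d (M : R) : 0 <= d ->
  (forall k, z k.+1 = z k + d * c k) -> (forall k, `|c k| <= M) ->
  forall i j, `|z i - z j| <= M * `|i%:R * d - j%:R * d|.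
Proof.
move=> d0 zS cM i j; wlog ij : i j / (i <= j)%N => [W|].
  have [/W//|/ltnW/W] := leqP i j.
  by rewrite distrC (distrC (j%:R * d)).
rewrite distrC (distrC (i%:R * d)) -mulrBl -natrB//.
rewrite (ger0_norm (_ : 0 <= _ * d)) ?mulr_ge0//.
have := @step_sum_approx z c d 0 M i (j - i) d0 zS.
rewrite mulr0 subr0 subnKC// => H.
have -> : M * ((j - i)%:R * d) = d * (j - i)%:R * M by ring.
by apply: H => k _; rewrite subr0.
Qed.

Lemma truncn_div_bound d s : 0 < d -> 0 <= s ->
  (Num.truncn (s / d))%:R * d <= s < (Num.truncn (s / d))%:R * d + d.
Proof.
move=> d0 s0; have /truncn_itv : 0 <= s / d by rewrite divr_ge0// ltW.
by rewrite ler_pdivlMr// ltr_pdivrMr// -natr1 mulrDl mul1r.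
Qed.

(** The grid points [i * d] and [j * d] reached by truncation lie less than [d] before [r] and [s].
    Hence the grid length is at most [s - r + d], and [|l| * d] pays for replacing it by [s - r]. *)
Lemma step_fun_approx z c d l e r s : 0 < d -> 0 <= r -> r <= s ->
  (forall k, z k.+1 = z k + d * c k) -> 0 <= e ->
  (forall k, r - d <= k%:R * d <= s -> `|c k - l| <= e) ->
  `|z (Num.truncn (s / d)) - z (Num.truncn (r / d)) - l * (s - r)|
    <= e * (s - r + d) + `|l| * d.
Proof.
move=> d0 r0 rs zS e0 cl.
have s0 := le_trans r0 rs.
have /andP[i1 i2] := truncn_div_bound d0 r0.
have /andP[j1 j2] := truncn_div_bound d0 s0.
set i := Num.truncn (r / d) in i1 i2 *; set j := Num.truncn (s / d) in j1 j2 *.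
have ij : (i <= j)%N.
  rewrite -ltnS -(ltr_nat R) -(ltr_pM2r d0) -natr1 mulrDl mul1r; lra.
have jE : (j%:R = i%:R + (j - i)%:R :> R) by rewrite -natrD subnKC.
have := @step_sum_approx z c d l e i (j - i) (ltW d0) zS.
rewrite subnKC// => H.
have cl' k : (i <= k < j)%N -> `|c k - l| <= e.
  move=> /andP[ik kj]; apply: cl; apply/andP; split.
    have : i%:R * d <= k%:R * d by rewrite ler_pM2r// ler_nat.
    lra.
  apply: le_trans j1; rewrite ler_pM2r// ler_nat; exact: ltnW.
have {cl'}H := H cl'.
set m := (j - i)%N in H jE.
have mE : d * m%:R = j%:R * d - i%:R * d by rewrite jE; ring.
rewrite mE in H.
have -> : z j - z i - l * (s - r) =
 (z j - z i - (j%:R * d - i%:R * d) * l) +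
   l * (j%:R * d - i%:R * d - (s - r)) by ring.
apply: (le_trans (ler_normD _ _)); apply: lerD.
  apply: (le_trans H); rewrite mulrC ler_wpM2l//; lra.
rewrite normrM ler_wpM2l// ler_norml; apply/andP; split; lra.
Qed.

End euler_steps.

(* Pointwise convergence of [z] suffices, because the slopes [c N] are close to
   [l] at all grid points near [t]. *)
Lemma step_limit_derive (R : realType) (U : set_system nat) (d : nat -> R)
    (z c : nat -> nat -> R) (Z : R -> R) (t l : R) :
  ProperFilter U -> (forall N, 0 < d N) -> d N @[N --> U] --> 0 ->
  (forall N k, z N k.+1 = z N k + d N * c N k) ->
  (forall s, 0 <= s -> z N (Num.truncn (s / d N)) @[N --> U] --> Z s) ->
  0 <= t ->
  (forall e, 0 < e -> exists2 eta, 0 < eta & \forall N \near U,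
     forall k, `|k%:R * d N - t| <= eta -> `|c N k - l| <= e) ->
  forall e, 0 < e -> exists2 eta, 0 < eta &
    forall s, 0 <= s -> `|s - t| <= eta ->
      `|Z s - Z t - l * (s - t)| <= e * `|s - t|.
Proof.
move=> UF d0 dto0 zS zZ t0 cl e e0.
have [eta eta0 Hc] := cl e e0.
(* The other half of [eta] absorbs the step size: the grid points involved may precede the left end
   of the interval by up to [d N]. *)
exists (eta / 2); first by rewrite divr_gt0.
move=> s s0 st.
have dsmall : \forall N \near U, d N <= eta / 2.
  have /cvgrPdist_le Hd := dto0.
  have := Hd (eta / 2) (divr_gt0 eta0 (ltr0Sn _ 1)).
  by apply: filterS => N /=; rewrite sub0r normrN gtr0_norm.
pose i N r := Num.truncn (r / d N).
have cvgL : `|z N (i N s) - z N (i N t) - l * (s - t)| @[N --> U] -->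
     `|Z s - Z t - l * (s - t)|.
  apply: cvg_norm; apply: cvgB; last exact: cvg_cst.
  by apply: cvgB; exact: zZ.
have cvgR : e * (`|s - t| + d N) + `|l| * d N @[N --> U] --> e * `|s - t|.
  have -> : e * `|s - t| = e * (`|s - t| + 0) + `|l| * 0 by ring.
  apply: cvgD; last by apply: cvgM => //; exact: cvg_cst.
  apply: cvgM; first exact: cvg_cst.
  by apply: cvgD => //; exact: cvg_cst.
(* It suffices to have the estimate with the [d N] terms for [U]-almost all [N]; these terms vanish
   in the limit. *)
apply: (ler_cvg_to cvgL cvgR).
near=> N.
have HN : forall k, `|k%:R * d N - t| <= eta -> `|c N k - l| <= e.
  by near: N.
have dN : d N <= eta / 2 by near: N.
have /= dN0 := d0 N.
have [ts|/ltW ts] := leP t s.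
  rewrite (ger0_norm (_ : 0 <= s - t)) ?subr_ge0// in st *.
  apply: step_fun_approx => //; first exact: ltW.
  move=> k /andP[k1 k2]; apply: HN; rewrite ler_norml; apply/andP; split; lra.
rewrite (distrC s t) (ger0_norm (_ : 0 <= t - s)) ?subr_ge0// in st *.
rewrite -normrN.
have -> : - (z N (i N s) - z N (i N t) - l * (s - t)) =
  z N (i N t) - z N (i N s) - l * (t - s) by ring.
apply: step_fun_approx => //; first exact: ltW.
move=> k /andP[k1 k2]; apply: HN; rewrite ler_norml; apply/andP; split; lra.
Unshelve. all: by end_near.
Qed.

(** * Explicit Euler scheme for x' = g(t, x, w), w' = F(t, x, w) with x(0) = 0, w(0) = [w0] *)

Lemma cvg_pair_pt (I : Type) (A B : topologicalType) (F : set_system I)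
    (u : I -> A) (v : I -> B) (a : A) (b : B) :
  Filter F -> u @ F --> a -> v @ F --> b ->
  (fun i => (u i, v i)) @ F --> (a, b).
Proof. by move=> FF ua vb; exact: (cvg_pair ua vb). Qed.

Section euler_scheme.
Context {R : realType}.
Variables g F : R * R * R -> R.

Fixpoint euler (d w0 : R) (k : nat) : R * R :=
  if k is j.+1 then
    let p := euler d w0 j in
    (p.1 + d * g (j%:R * d, p.1, p.2), p.2 + d * F (j%:R * d, p.1, p.2))
  else (0, w0).

Lemma euler_continuous (d : R) k : continuous g -> continuous F ->
  continuous (fun w0 => euler d w0 k).
Proof.
move=> gc Fc; elim: k => [|k IH] w /=.
  by apply: cvg_pair_pt => /=; [exact: cvg_cst|exact: cvg_id].
have c1 : (euler d v k).1 @[v --> w] --> (euler d w k).1.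
  by apply: cvg_comp (IH w) _; exact: cvg_fst.
have c2 : (euler d v k).2 @[v --> w] --> (euler d w k).2.
  by apply: cvg_comp (IH w) _; exact: cvg_snd.
have c3 : (k%:R * d, (euler d v k).1, (euler d v k).2) @[v --> w] -->
    (k%:R * d, (euler d w k).1, (euler d w k).2).
  by apply: cvg_pair_pt => //; apply: cvg_pair_pt => //; exact: cvg_cst.
apply: cvg_pair_pt.
  apply: cvgD => //; apply: cvgM; first exact: cvg_cst.
  exact: cvg_comp c3 (gc _).
apply: cvgD => //; apply: cvgM; first exact: cvg_cst.
exact: cvg_comp c3 (Fc _).
Qed.

End euler_scheme.

(** Turns the division-free estimate delivered by [step_limit_derive] into a derivative. *)
Lemma slope_cvg (R : realType) (A : set R) (Z : R -> R) (t l : R) :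
  (forall e, 0 < e -> exists2 eta, 0 < eta &
    forall s, A s -> `|s - t| <= eta ->
      `|Z s - Z t - l * (s - t)| <= e * `|s - t|) ->
  diff_quot Z t @ within A t^' --> l.
Proof.
move=> H; apply/cvgrPdist_le => e e0.
have [eta eta0 He] := H e e0.
rewrite /within /dnbhs; near_simpl => /=.
apply/nbhs_ballP; exists eta => //= s; rewrite /ball /= => st snt As.
have st0 : s - t != 0 by rewrite subr_eq0.
rewrite distrC /diff_quot.
have -> : (Z s - Z t) / (s - t) - l = (Z s - Z t - l * (s - t)) / (s - t).
  by rewrite [RHS]mulrBl mulfK.
rewrite normrM normfV ler_pdivrMr ?normr_gt0//.
by apply: He => //; rewrite distrC ltW.
Qed.

(** * Shooting in the initial momentum, and passage to the limit *)

Section shooting.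
Context {R : realType}.
Variables (g F : R * R * R -> R) (T M K : R).
Hypotheses (T0 : 0 < T) (gc : continuous g) (Fc : continuous F).
Hypotheses (gM : forall p, `|g p| <= M) (FK : forall p, `|F p| <= K).
Hypothesis gsgn : forall p, p.2 != 0 -> 0 < p.2 * g p.

Let xe d w0 k := (euler g F d w0 k).1.
Let we d w0 k := (euler g F d w0 k).2.

Let xe_lip d w0 : 0 <= d -> forall i j,
  `|xe d w0 i - xe d w0 j| <= M * `|i%:R * d - j%:R * d|.
Proof.
move=> d0; apply: (step_lipschitz (c := fun k =>
  g (k%:R * d, xe d w0 k, we d w0 k))) => //.
Qed.

Let we_lip d w0 : 0 <= d -> forall i j,
  `|we d w0 i - we d w0 j| <= K * `|i%:R * d - j%:R * d|.
Proof.
move=> d0; apply: (step_lipschitz (c := fun k =>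
  F (k%:R * d, xe d w0 k, we d w0 k))) => //.
Qed.

(** As long as the momentum has the sign of [s], every increment of the position has it too. Only
    [s = 1] and [s = -1] are used, to treat both signs at once. *)
Lemma euler_sign s d w0 N : 0 < d ->
  (forall k, (k <= N)%N -> 0 < s * we d w0 k) -> 0 < s * xe d w0 N.+1.
Proof.
move=> d0 sw.
have sg k : (k <= N)%N -> 0 < s * (d * g (k%:R * d, xe d w0 k, we d w0 k)).
  move=> kN; have swk := sw k kN.
  have w_neq0 : we d w0 k != 0.
    by apply: contraTneq swk => ->; rewrite mulr0 ltxx.
  have := @gsgn (k%:R * d, xe d w0 k, we d w0 k) w_neq0 => /= wg.
  (* Multiplying by the square of the momentum turns the sign of [s * g] into that of the product of
     [s * w] and [w * g], both positive. *)
  have w2 : 0 < we d w0 k * we d w0 k by rewrite -expr2 exprn_even_gt0.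
  rewrite mulrCA pmulr_rgt0// -(pmulr_rgt0 _ w2).
  have -> : forall G W : R, W * W * (s * G) = (s * W) * (W * G) by move=> *; ring.
  by rewrite mulr_gt0.
suff : 0 <= s * xe d w0 N.
  by move=> x0; rewrite /xe /= mulrDr ltr_wpDl// sg.
have : (N <= N)%N by [].
elim: {-2}N => [|k IH] kN; first by rewrite /xe /= mulr0.
by rewrite /xe /= mulrDr addr_ge0// ?IH ?(ltnW kN)// ltW// sg// ltnW.
Qed.

(** Up to time [T] the momentum drifts by at most [K * T], so starting from [B] or [- B] it never
    changes sign. *)
Let B := K * T + 1.

Lemma euler_hit N : exists2 w0, `|w0| <= B &
  xe (T / N.+1%:R) w0 N.+1 = 0.
Proof.
set d := T / N.+1%:R.
have d0 : 0 < d by rewrite divr_gt0.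
have K0 : 0 <= K by exact: le_trans (FK (0, 0, 0)).
have T_ge0 : 0 <= T := ltW T0.
have B0 : 0 < B by rewrite ltr_wpDl// mulr_ge0.
have wB w0 k : (k <= N)%N -> `|we d w0 k - w0| <= K * T.
  move=> kN; apply: le_trans (@we_lip d w0 (ltW d0) k 0%N) _.
  rewrite mul0r subr0 ler_wpM2l// ger0_norm ?mulr_ge0 ?(ltW d0)//.
  have TE : N.+1%:R * d = T by rewrite mulrC divfK.
  by rewrite -[leRHS]TE ler_pM2r// ler_nat ltnW// ltnS.
have xp : 0 < 1 * xe d B N.+1.
  apply: euler_sign => // j jN; have := wB B j jN.
  rewrite ler_norml /B => /andP[? ?]; lra.
have xn : 0 < (-1) * xe d (- B) N.+1.
  apply: euler_sign => // j jN; have := wB (- B) j jN.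
  rewrite ler_norml /B => /andP[? ?]; lra.
have [||//|w wB' xw] := @IVT R (fun w => xe d w N.+1) (- B) B 0.
- lra.
- apply: continuous_subspaceT => w.
  have : xe d v N.+1 @[v --> w] --> xe d w N.+1; last by [].
  have ew : euler g F d v N.+1 @[v --> w] --> euler g F d w N.+1.
    exact: euler_continuous.
  by apply: cvg_comp ew _; exact: cvg_fst.
- rewrite ge_min le_max; apply/andP; split; apply/orP; [left|right]; lra.
- by exists w => //; rewrite ler_norml.
Qed.

(** Derivatives are relative to the half-line because the schemes run on past [T]; the bound [M * t]
    later makes the truncation of the position inactive. *)
Lemma shooting : exists X W : R -> R,
  [/\ X 0 = 0, X T = 0, forall t, 0 <= t -> `|X t| <= M * t,
      forall t, 0 <= t ->
        diff_quot X t @ within [set s | 0 <= s] t^' --> g (t, X t, W t) &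
      forall t, 0 <= t ->
        diff_quot W t @ within [set s | 0 <= s] t^' --> F (t, X t, W t)].
Proof.
have M0 : 0 <= M by exact: le_trans (gM (0, 0, 0)).
have K0 : 0 <= K by exact: le_trans (FK (0, 0, 0)).
have T_ge0 : 0 <= T := ltW T0.
have /choice[w0 w0P] : forall N, exists w0 : R, `|w0| <= B /\
  xe (T / N.+1%:R) w0 N.+1 = 0.
  by move=> N; have [w] := euler_hit N; exists w.
(* Along an ultrafilter finer than the filter at infinity every bounded sequence converges, so no
   subsequence has to be extracted. *)
have [U [UU oU]] := ultraFilterLemma (eventually_filter).
have UF : ProperFilter U by exact: ultra_proper.
pose d N := T / N.+1%:R.
have d0 N : 0 < d N by rewrite divr_gt0.
have dto0 : d N @[N --> U] --> 0.
  have : d N @[N --> \oo] --> 0.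
    rewrite -[X in _ --> X](mulr0 T); apply: cvgM; first exact: cvg_cst.
    exact: cvg_harmonic.
  by move=> dN V /dN; exact: oU.
pose i s N := Num.truncn (s / d N).
pose x N := xe (d N) (w0 N).
pose w N := we (d N) (w0 N).
have iP s N : 0 <= s -> (i s N)%:R * d N <= s < (i s N)%:R * d N + d N.
  by move=> s0; exact: truncn_div_bound.
pose X s := lim (x N (i s N) @[N --> U]).
pose W s := lim (w N (i s N) @[N --> U]).
have xM s N : 0 <= s -> `|x N (i s N)| <= M * s.
  move=> s0.
  have := @xe_lip (d N) (w0 N) (ltW (d0 N)) (i s N) 0%N.
  rewrite {2}/xe /= subr0 mul0r subr0 => /le_trans; apply.
  rewrite ler_wpM2l// ger0_norm ?mulr_ge0 ?(ltW (d0 N))//.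
  by case/andP : (iP s N s0).
have xX s : 0 <= s -> x N (i s N) @[N --> U] --> X s.
  by move=> s0; apply: (@ultra_bounded_cvg _ _ _ _ (M * s)) => // N; exact: xM.
have wW s : 0 <= s -> w N (i s N) @[N --> U] --> W s.
  move=> s0; apply: (@ultra_bounded_cvg _ _ _ _ (B + K * s)) => // N.
  have := @we_lip (d N) (w0 N) (ltW (d0 N)) (i s N) 0%N.
  rewrite {2}/we /= mul0r subr0 => H.
  rewrite -(subrK (w0 N) (w N _)) addrC; apply: (le_trans (ler_normD _ _)).
  apply: lerD; first by case: (w0P N).
  apply: (le_trans H).
  rewrite ler_wpM2l// ger0_norm ?mulr_ge0 ?(ltW (d0 N))//.
  by case/andP : (iP s N s0).
(* This is the slope hypothesis of [step_limit_derive], proved once and used for both [g] and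
   [F]. *)
have key (Phi : R * R * R -> R) t : 0 <= t -> continuous Phi ->
  forall e, 0 < e -> exists2 eta, 0 < eta & \forall N \near U,
     forall k, `|k%:R * d N - t| <= eta ->
       `|Phi (k%:R * d N, x N k, w N k) - Phi (t, X t, W t)| <= e.
  move=> t0 Phic e e0.
  have /cvgrPdist_le/(_ e e0)/nbhs_ballP[r /= r0 Hr] := Phic (t, X t, W t).
  (* [L] dominates both Lipschitz constants and 1. Convergence at [t] costs [r / 4], and moving from
     index [i t N] to [k], over a time of at most [2 * eta], costs at most [r / 2]; the total stays
     below [r]. *)
  pose L := M + K + 1.
  have L0 : 0 < L by rewrite /L; lra.
  pose eta := r / (4 * L).
  have etaL : 4 * (L * eta) = r by rewrite /eta; field; rewrite gt_eqF.
  have eta0 : 0 < eta by rewrite divr_gt0// mulr_gt0.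
  exists eta => //.
  have r4 : 0 < r / 4 by rewrite divr_gt0.
  have /cvgrPdist_le/(_ _ r4) xn := xX t t0.
  have /cvgrPdist_le/(_ _ r4) wn := wW t t0.
  have /cvgrPdist_le/(_ _ eta0) dn := dto0.
  near=> N => k kt.
  have dN : d N <= eta.
    have : `|0 - d N| <= eta by near: N.
    by rewrite sub0r normrN gtr0_norm.
  have ki : `|k%:R * d N - (i t N)%:R * d N| <= 2 * eta.
    have /andP[i1 i2] := iP t N t0.
    by move: kt; rewrite !ler_norml => /andP[? ?]; apply/andP; split; lra.
  have etaM : M * eta <= L * eta by rewrite ler_pM2r// /L; lra.
  have etaK : K * eta <= L * eta by rewrite ler_pM2r// /L; lra.
  have etaL1 : 1 * eta <= L * eta by rewrite ler_pM2r// /L; lra.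
  have xk : `|X t - x N k| < r.
    have h1 : `|X t - x N (i t N)| <= r / 4 by near: N.
    have h2 := le_trans (@xe_lip (d N) (w0 N) (ltW (d0 N)) k (i t N))
      (ler_wpM2l M0 ki).
    rewrite distrC in h2.
    rewrite (le_lt_trans (ler_distD (x N (i t N)) _ _))//.
    move: h1 h2; rewrite -/(x N) -/(x N _); lra.
  have wk : `|W t - w N k| < r.
    have h1 : `|W t - w N (i t N)| <= r / 4 by near: N.
    have h2 := le_trans (@we_lip (d N) (w0 N) (ltW (d0 N)) k (i t N))
      (ler_wpM2l K0 ki).
    rewrite distrC in h2.
    rewrite (le_lt_trans (ler_distD (w N (i t N)) _ _))//.
    move: h1 h2; rewrite -/(w N) -/(w N _); lra.
  rewrite distrC; apply: Hr; split => //; split => //.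
  by rewrite /ball /= distrC; lra.
exists X, W; split.
- rewrite /X; have -> : (fun N => x N (i 0 N)) = cst 0.
    by apply/funext => N; rewrite /i mul0r truncn0.
  exact: lim_cst.
(* [T / d N] is exactly [N.+1], the index at which the choice of [w0 N] makes the position
   vanish. *)
- rewrite /X; have -> : (fun N => x N (i T N)) = cst 0.
    apply/funext => N; rewrite /i /d invf_div mulrCA divff ?gt_eqF// mulr1.
    by rewrite natrK; case: (w0P N).
  exact: lim_cst.
- move=> t t0; apply: (ler_cvg_to (cvg_norm (xX t t0)) (cvg_cst (M * t))).
  by apply: nearW => N; exact: xM.
- move=> t t0; apply: slope_cvg.
  exact: (step_limit_derive UF d0 dto0 (fun N k => erefl) xX t0 (key _ t t0 gc)).
- move=> t t0; apply: slope_cvg.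
  exact: (step_limit_derive UF d0 dto0 (fun N k => erefl) wW t0 (key _ t t0 Fc)).
Unshelve. all: by end_near.
Qed.

End shooting.

(** * Truncation to a segment and relative continuity *)

Section clip.
Context {R : realType}.
Implicit Types l r x : R.

Definition clip l r x := Num.max l (Num.min r x).

Lemma clip_itv l r x : l <= r -> clip l r x \in `[l, r].
Proof.
by move=> lr; rewrite in_itv /= /clip le_max lexx ge_max lr ge_min lexx.
Qed.

Lemma clip_id l r x : x \in `[l, r] -> clip l r x = x.
Proof.
by rewrite in_itv /= /clip => /andP[lx xr]; rewrite (min_r xr) (max_r lx).
Qed.

Lemma clip_continuous l r : continuous (clip l r).
Proof.
apply: max_fun_continuous; first by move=> x; exact: cvg_cst.
by apply: min_fun_continuous => x; [exact: cvg_cst | exact: cvg_id].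
Qed.

(* [x] is a positive multiple of [clip (- r) r x]. *)
Lemma clip_mul_ge0 r x (c : R) : 0 < r ->
  0 <= clip (- r) r x * c -> 0 <= x * c.
Proof.
move=> r0; have [xr|xr] := leP r x.
  rewrite /clip (min_l xr) max_r; last lra.
  rewrite pmulr_rge0// => c0; rewrite mulr_ge0//; lra.
have [xr'|xr'] := leP x (- r).
  rewrite /clip (min_r (ltW xr)) (max_l xr').
  rewrite nmulr_rge0; last lra.
  move=> c0; rewrite mulr_le0//; lra.
by rewrite clip_id// in_itv /=; apply/andP; split; apply: ltW.
Qed.

End clip.

(** Serves outer maps continuous only on a subset, such as the inverse of [phi] on []- a, a[] or [f]
    for times in [[0, T]]. *)
Lemma cvg_within_comp (I : Type) (T S : topologicalType) (F : set_system I)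
    (A : set T) (u : I -> T) (f : T -> S) (x : T) (y : S) :
  Filter F -> u @ F --> x -> (\forall i \near F, A (u i)) ->
  f @ within A (nbhs x) --> y -> f (u i) @[i --> F] --> y.
Proof.
move=> FF ux Au fy V /fy /= fV.
have := ux _ fV; rewrite /nbhs /= => uV.
by apply: filterS2 Au uV => i Ai; apply.
Qed.

(** * Derivatives relative to [[0, T]] *)

Section interval_derivative.
Context {R : realType}.
Variable T : R.
Hypothesis T0 : 0 < T.
Let I : set R := [set` `[0, T]].

(** Properness makes limits of difference quotients unique. Points in the left half of the interval
    are approached from the right, the others from the left. *)
Lemma itv_within_dnbhs_proper t : I t -> ProperFilter (within I t^').
Proof.
rewrite /I /= in_itv /= => /andP[t0 tT].
apply: Build_ProperFilter => -[e /= e0 He].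
pose r := Num.min (e / 2) (T / 2).
have r0 : 0 < r by rewrite lt_min !divr_gt0.
have re : r <= e / 2 by rewrite ge_min lexx.
have rT : r <= T / 2 by rewrite ge_min lexx orbT.
have [tT2|tT2] := leP t (T / 2).
  apply: (He (t + r)).
  - rewrite /ball /= ltr_norml; apply/andP; split; lra.
  - by rewrite eq_sym -subr_eq0 opprD addNKr oppr_eq0 gt_eqF.
  - rewrite /= in_itv /=; apply/andP; split; lra.
apply: (He (t - r)).
- rewrite /ball /= ltr_norml; apply/andP; split; lra.
- by rewrite -subr_eq0 addrAC subrr add0r oppr_eq0 gt_eqF.
- rewrite /= in_itv /=; apply/andP; split; lra.
Qed.

Lemma derive_inE Z (t l : R) : I t -> diff_quot Z t @ within I t^' --> l ->
  derivable_in I Z t /\ derive_in I Z t = l.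
Proof.
move=> It Zl; have pf := itv_within_dnbhs_proper It.
by split; [apply/cvg_ex; exists l | exact: cvg_lim].
Qed.

Lemma eq_diff_quot_cvg (Z V : R -> R) (t l : R) :
  (forall s, I s -> Z s = V s) -> I t ->
  diff_quot Z t @ within I t^' --> l -> diff_quot V t @ within I t^' --> l.
Proof.
move=> ZV It Zl P /Zl; apply: (@filterS _ t^') => s Ps Is.
by have := Ps Is; rewrite /= /diff_quot !ZV.
Qed.

(** Near [t] the difference quotients are bounded by [|z t| + 1], which gives a Lipschitz estimate
    at [t]. *)
Lemma diff_quot_continuous Z (z : R -> R) :
  (forall t, I t -> diff_quot Z t @ within I t^' --> z t) ->
  {within I, continuous Z}.
Proof.
move=> Zz; apply/subspace_continuousP => t It.
apply/cvgrPdist_le => e e0.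
have /cvgrPdist_le/(_ 1 ltr01)[d /= d0 Hd] := Zz t It.
pose L := `|z t| + 1.
have L0 : 0 < L by rewrite /L ltr_wpDl.
exists (Num.min d (e / L)); first by rewrite /= lt_min d0 divr_gt0.
move=> s /=; rewrite /ball /= lt_min => /andP[sd se] Is.
have [->|st] := eqVneq s t; first by rewrite subrr normr0 ltW.
have st0 : s - t != 0 by rewrite subr_eq0.
have := Hd s sd st Is; rewrite /diff_quot => H.
have H2 : `|(Z s - Z t) / (s - t)| <= L.
  rewrite -(subrK (z t) ((Z s - Z t) / (s - t))) addrC /L.
  by apply: (le_trans (ler_normD _ _)); rewrite lerD2l distrC.
rewrite distrC -[X in `|X|](divfK st0) normrM.
apply: (le_trans (ler_wpM2r (normr_ge0 _) H2)).
by rewrite mulrC -ler_pdivlMr// distrC ltW.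
Qed.

(** Gives access to Rolle's theorem and the monotonicity criterion, both stated with ordinary
    derivatives in the interior. *)
Lemma diff_quot_is_derive Z (t l : R) : t \in `]0, T[ ->
  diff_quot Z t @ within I t^' --> l -> is_derive t (1 : R) Z l.
Proof.
rewrite in_itv /= => /andP[t0 tT] Zl.
suff H : h^-1 *: (Z (h *: (1 : R) + t) - Z t) @[h --> 0^'] --> l.
  by apply: DeriveDef; [apply/cvg_ex; exists l|exact: cvg_lim H].
apply/cvgrPdist_le => e e0.
have /cvgrPdist_le/(_ e e0)[d /= d0 Hd] := Zl.
exists (Num.min d (Num.min t (T - t))); first by rewrite /= !lt_min d0 t0 subr_gt0.
move=> h /=; rewrite /ball /= sub0r normrN !lt_min => /and3P[hd ht hT] h0.
have htT : I (h + t).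
  rewrite /I /= in_itv /=; move: ht hT; rewrite !ltr_norml => /andP[? ?] /andP[? ?].
  by apply/andP; split; lra.
have := Hd (h + t) _ _ htT.
rewrite /diff_quot addrK [h *: _]mulr1 mulrC; apply.
  by rewrite /ball /= opprD addrCA subrr addr0 normrN.
by rewrite -subr_eq0 addrK.
Qed.

End interval_derivative.

(** * The a priori bound on the momentum *)

Lemma continuous_primitive (R : realType) (T : R) (h : R -> R) :
  0 < T -> {within `[0, T], continuous h} -> exists H : R -> R,
  [/\ {within `[0, T], continuous H},
      forall t, t \in `]0, T[ -> is_derive t (1 : R) H (h t),
      H 0 = 0 & H T = \int[lebesgue_measure]_(t in `[0, T]) h t].
Proof.
move=> T0 hc.
have hint : lebesgue_measure.-integrable `[0, T] (EFin \o h).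
  by apply: continuous_compact_integrable => //; exact: segment_compact.
exists (fun t => \int[lebesgue_measure]_(s in `[0, t]) h s); split => //.
- exact: parameterized_integral_continuous (ltW T0) hint.
- move=> t tT.
  have /andP[t0 t1] : 0 < t < T by rewrite in_itv in tT.
  have hct : {for t, continuous h}.
    apply: (@cvg_within_comp _ _ _ (nbhs t) [set` `[0, T]] id).
    - exact: cvg_id.
    - by apply: filterS (near_in_itvoo tT) => s; exact: subset_itv_oo_cc.
    - by move/subspace_continuousP : hc; apply; exact: subset_itv_oo_cc.
  have [dH H'] := continuous_FTC1_closed t1 hint t0 hct.
  by apply: (DeriveDef dH); rewrite -derive1E; exact: H'.
- by rewrite set_itv1 Rintegral_set1.
Qed.

Section a_priori.
Context {R : realType}.
Variables (T : R) (X W g n h : R -> R) (f : R -> R -> R -> R).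
Let I : set R := [set` `[0, T]].
Hypothesis T0 : 0 < T.
Hypotheses (X0 : X 0 = 0) (XT : X T = 0).
Hypothesis X' : forall t, I t -> diff_quot X t @ within I t^' --> g (W t).
Hypothesis W' : forall t, I t ->
  diff_quot W t @ within I t^' --> f t (X t) (g (W t)).
Hypothesis g_neq0 : forall w, g w = 0 -> w = 0.
Hypothesis h_cont : {within `[0, T], continuous h}.
Hypotheses (n_derivable : forall x : R, derivable n x 1) (n0 : n 0 = 0).
Hypothesis n'_sign : forall w x, 0 <= w * (n^`()%classic x * g w).
Hypothesis f_bound : forall t x y : R, t \in `[0, T] ->
  `|f t x y| <= f t x y * n x + h t.

(* The monotone majorant is [G = W * (n o X) + H] with [H' = h]: the sign of
   [n'] gives [G' >= f * n + h >= |W'|], while [G] vanishes at [0] and equals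
   the integral of [h] at [T]. *)
Lemma momentum_bound t : I t ->
  `|W t| <= \int[lebesgue_measure]_(t in `[0, T]) h t.
Proof.
move=> It; have [H [Hc H' H0 HT]] := continuous_primitive T0 h_cont.
have Xc : {within I, continuous X} := diff_quot_continuous X'.
have Wc : {within I, continuous W} := diff_quot_continuous W'.
have nc : continuous n.
  by move=> x; apply: differentiable_continuous; exact/derivable1_diffP.
pose G := W * (n \o X) + H.
have Gc : {within I, continuous G}.
  apply/subspace_continuousP => s Is; apply: cvgD.
    apply: cvgM; first by move/subspace_continuousP : Wc; exact.
    apply: continuous_cvg; first exact: nc.
    by move/subspace_continuousP : Xc; exact.
  by move/subspace_continuousP : Hc; exact.
pose G' s := W s * (n^`()%classic (X s) * g (W s)) +
  (f s (X s) (g (W s)) * n (X s) + h s).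
have iI s : s \in `]0, T[ -> I s by exact: subset_itv_oo_cc.
have XD s : s \in `]0, T[ -> is_derive s (1 : R) X (g (W s)).
  by move=> sT; apply: (diff_quot_is_derive sT); exact/X'/iI.
have WD s : s \in `]0, T[ -> is_derive s (1 : R) W (f s (X s) (g (W s))).
  by move=> sT; apply: (diff_quot_is_derive sT); exact/W'/iI.
have GD s : s \in `]0, T[ -> is_derive s (1 : R) G (G' s).
  move=> sT; have := XD s sT; have := WD s sT; have := H' s sT => Hs Ws Xs.
  have ns : is_derive (X s) (1 : R) n (n^`()%classic (X s)).
    by split; [exact: n_derivable | rewrite derive1E].
  have nXs : is_derive s (1 : R) (n \o X) (n^`()%classic (X s) * g (W s)).
    exact: is_derive1_comp.
  have := is_deriveD (is_deriveM Ws nXs) Hs.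
  congr (is_derive _ _ _ _); rewrite /G' /= -addrA; congr (_ + (_ + _)).
  by rewrite mulrC.
have G'W s : I s -> `|f s (X s) (g (W s))| <= G' s.
  move=> Is; apply: (le_trans (f_bound _ _ Is)).
  by rewrite /G' lerDr.
(* The derivative of [G + e * W] is at least [G' - |W'|], hence nonnegative. The values [e = 1] and
   [e = -1] bound increments of [W] by those of [G]; [e = 0] says that [G] is nondecreasing. *)
have mono (e : R) x y : `|e| <= 1 -> 0 <= x -> x <= y -> y <= T ->
    G x + e * W x <= G y + e * W y.
  move=> e1 x0 xy yT.
  have D s : s \in `]0, T[ ->
      is_derive s (1 : R) (G + e *: W) (G' s + e * f s (X s) (g (W s))).
    by move=> sT; apply: is_deriveD; [exact: GD | apply: is_deriveZ; exact: WD].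
  refine (@ger0_derive1_ndecr R (G + e *: W) 0 T _ _ _ x y x0 xy yT).
  - by move=> s sT; case: (D s sT).
  - move=> s sT; rewrite derive1E; case: (D s sT) => _ ->.
    have := G'W s (iI s sT); set fs := f _ _ _ => H1.
    have : `|e * fs| <= `|fs| by rewrite normrM ler_piMl.
    rewrite ler_norml => /andP[? _]; lra.
  - apply/subspace_continuousP => s Is; apply: cvgD.
      by move/subspace_continuousP : Gc; exact.
    apply: cvgM; first exact: cvg_cst.
    by move/subspace_continuousP : Wc; exact.
have XDb s : s \in `]0, T[ -> derivable X s 1.
  by move=> sT; case: (XD s sT).
have [tau tauT tau0] := Rolle T0 XDb Xc (etrans X0 (esym XT)).
have Wtau : W tau = 0.
  apply: g_neq0; case: (XD tau tauT) => _ <-.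
  by case: tau0.
have GE0 : G 0 = 0 by rewrite /G !fctE /= X0 n0 mulr0 H0 addr0.
have GET : G T = H T by rewrite /G !fctE /= XT n0 mulr0 add0r.
move: (tauT) It; rewrite /I /= !in_itv /= => /andP[tau1 tau2] /andP[t1 t2].
have e1 : `|1 : R| <= 1 by rewrite normr1.
have eN1 : `|-1 : R| <= 1 by rewrite normrN1.
have e0 : `|0 : R| <= 1 by rewrite normr0.
rewrite -HT -GET.
(* To the right of [tau], [|W t| <= G t - G tau <= G T - G 0]; to the left, the same with [t] and
   [tau] exchanged. *)
have [tt|/ltW tt] := leP tau t.
  have := mono 1 tau t e1 (ltW tau1) tt t2.
  have := mono (-1) tau t eN1 (ltW tau1) tt t2.
  have := mono 0 t T e0 t1 t2 (lexx T).
  have := mono 0 0 tau e0 (lexx 0) (ltW tau1) (ltW tau2).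
  rewrite Wtau GE0 => ? ? ? ?; rewrite ler_norml; apply/andP; split; lra.
have := mono 1 t tau e1 t1 tt (ltW tau2).
have := mono (-1) t tau eN1 t1 tt (ltW tau2).
have := mono 0 0 t e0 (lexx 0) t1 t2.
have := mono 0 tau T e0 (ltW tau1) (ltW tau2) (lexx T).
rewrite Wtau GE0 => ? ? ? ?; rewrite ler_norml; apply/andP; split; lra.
Qed.

End a_priori.

(** * The Dirichlet problem for the system with bounded [g] *)

Lemma within_compact_bounded (R : realType) (S : topologicalType) (A : set S)
    (u : S -> R) :
  compact A -> {within A, continuous u} ->
  exists K, forall x, A x -> `|u x| <= K.
Proof.
move=> cA uc; have /compact_bounded := continuous_compact uc cA.
move=> /pinfty_ex_gt0[K _ HK]; exists K => x Ax.
by apply: HK; exists x.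
Qed.

Lemma diff_quotN (R : realType) (A : set R) (Z : R -> R) (t l : R) :
  diff_quot Z t @ within A t^' --> l ->
  diff_quot (fun s => - Z s) t @ within A t^' --> - l.
Proof.
move=> Zl; have -> : diff_quot (fun s => - Z s) t = (fun s => - diff_quot Z t s).
  by apply/funext => s; rewrite /diff_quot -opprD mulNr.
exact: cvgN.
Qed.

Section dirichlet_system.
Context {R : realType}.
Variables (T M : R).
Hypothesis T0 : 0 < T.
Let I : set R := [set` `[0, T]].

Lemma dirichlet_system_pos (g : R -> R) (f : R -> R -> R -> R) :
  continuous g -> (forall w, `|g w| <= M) ->
  (forall w, w != 0 -> 0 < w * g w) ->
  {within [set p : R * R * R | p.1.1 \in `[0, T]],
    continuous (fun p : R * R * R => f p.1.1 p.1.2 p.2)} ->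
  exists X W : R -> R, [/\ X 0 = 0, X T = 0,
    forall t, I t -> diff_quot X t @ within I t^' --> g (W t) &
    forall t, I t -> diff_quot W t @ within I t^' --> f t (X t) (g (W t))].
Proof.
move=> gc gM gsgn fc.
have M0 : 0 <= M by exact: le_trans (gM 0).
(* Positions stay within [M * T], so [f] may be frozen outside [[- C, C]] and outside [[0, T]]. Its
   last argument is a value of [g], already in [[- M, M]]; hence the field is bounded by
   compactness. *)
pose C := M * T.
have C0 : 0 <= C by rewrite mulr_ge0// ltW.
have NC : - C <= C by lra.
pose c (p : R * R * R) := (clip 0 T p.1.1, clip (- C) C p.1.2, g p.2).
pose ff (p : R * R * R) := f p.1.1 p.1.2 p.2.
have cc : continuous c.
  move=> p; apply: cvg_pair_pt; first apply: cvg_pair_pt.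
  - apply: (cvg_comp (fun q : R * R * R => q.1.1) (clip 0 T)).
      by apply: (cvg_comp fst fst); exact: cvg_fst.
    exact: clip_continuous.
  - apply: (cvg_comp (fun q : R * R * R => q.1.2) (clip (- C) C)).
      by apply: (cvg_comp fst snd); [exact: cvg_fst | exact: cvg_snd].
    exact: clip_continuous.
  - by apply: (cvg_comp snd g); [exact: cvg_snd | exact: gc].
have cI p : (c p).1.1 \in `[0, T] by rewrite /c /= clip_itv// ltW.
have Fc : continuous (ff \o c).
  move=> p; apply: (@cvg_within_comp _ _ _ (nbhs p)
    [set p : R * R * R | p.1.1 \in `[0, T]] c ff (c p)).
  - exact: cc.
  - by apply: filterE => q; exact: cI.
  - by move/subspace_continuousP : fc; apply; exact: cI.
have [K FK] : exists K, forall p, `|(ff \o c) p| <= K.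
  pose Q : set (R * R * R) := (I `*` [set` `[- C, C]]) `*` [set` `[- M, M]].
  have cQ : compact Q.
    by apply: compact_setX; [apply: compact_setX|]; exact: segment_compact.
  have fQ : {within Q, continuous ff}.
    by apply: continuous_subspaceW fc => p [[]].
  have [K HK] := within_compact_bounded cQ fQ.
  exists K => p; apply: HK; split; first split => /=.
  - exact: cI.
  - exact: clip_itv.
  - by rewrite /= in_itv /= -ler_norml.
have g2c : continuous (fun p : R * R * R => g p.2).
  by move=> p; apply: (cvg_comp snd g); [exact: cvg_snd | exact: gc].
have [X [W [X0 XT XM X' W']]] := @shooting R (fun p => g p.2) (ff \o c) T M K T0
  g2c Fc (fun p => gM p.2) FK
  (fun p => gsgn p.2).
have sub t : within I t^' `=>` within [set s | 0 <= s] t^'.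
  move=> P; apply: (@filterS _ t^') => s Ps Is; apply: Ps.
  by move: Is; rewrite /I /= in_itv /= => /andP[].
have I0 t : I t -> 0 <= t by rewrite /I /= in_itv /= => /andP[].
exists X, W; split => // t It.
  by apply: cvg_trans (X' t (I0 t It)); apply: cvg_app; exact: sub.
(* Along the solution both truncations are inactive. *)
have -> : f t (X t) (g (W t)) = (ff \o c) (t, X t, W t).
  rewrite /ff /c /= !clip_id// in_itv /= -ler_norml.
  apply: le_trans (XM t (I0 t It)) _; rewrite ler_wpM2l//.
  by move: It; rewrite /I /= in_itv /= => /andP[].
by apply: cvg_trans (W' t (I0 t It)); apply: cvg_app; exact: sub.
Qed.

Lemma dirichlet_system (g : R -> R) (f : R -> R -> R -> R) :
  continuous g -> (forall w, `|g w| <= M) ->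
  (forall w, w != 0 -> 0 < w * g w) \/ (forall w, w != 0 -> w * g w < 0) ->
  {within [set p : R * R * R | p.1.1 \in `[0, T]],
    continuous (fun p : R * R * R => f p.1.1 p.1.2 p.2)} ->
  exists X W : R -> R, [/\ X 0 = 0, X T = 0,
    forall t, I t -> diff_quot X t @ within I t^' --> g (W t) &
    forall t, I t -> diff_quot W t @ within I t^' --> f t (X t) (g (W t))].
Proof.
move=> gc gM [gsgn|gsgn] fc; first exact: dirichlet_system_pos.
(* The substitution [V = - W] reverses the sign of [w * g w] and of the right-hand side. *)
have [||||X [V [X0 XT X' V']]] := @dirichlet_system_pos (fun w => g (- w))
  (fun t x y => - f t x y).
- by move=> w; apply: (cvg_comp -%R g); [exact: opp_continuous | exact: gc].
- by move=> w; exact: gM.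
- by move=> w w0; have := gsgn (- w); rewrite oppr_eq0 mulNr oppr_lt0; exact.
- apply/subspace_continuousP => p Ip; apply: cvgN.
  by move/subspace_continuousP : fc; exact.
exists X, (fun s => - V s); split => // t It.
by rewrite -[f _ _ _]opprK; exact/diff_quotN/V'.
Qed.

End dirichlet_system.

(** * Reduction of the problem to the truncated system *)

Theorem theorem3p4 (R : realType) (T a : R) (phi : R -> R)
    (f : R -> R -> R -> R) (h n : R -> R)
    (T_gt0 : 0 < T) (a_gt0 : 0 < a)
    (phi_homeo : homeomorphism_onto phi [set` `]- a, a[])
    (phi0 : phi 0 = 0)
    (f_cont : {within [set p : R * R * R | p.1.1 \in `[0, T]],
                 continuous (fun p : R * R * R => f p.1.1 p.1.2 p.2)})
    (h_cont : {within `[0, T], continuous h})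
    (h_ge0 : forall t : R, t \in `[0, T] -> 0 <= h t)
    (n_derivable : forall x : R, derivable n x 1)
    (n'_cont : continuous (derive1 n))
    (h_L1 : (\int[lebesgue_measure]_(t in `[0%R, T]) `|h t|%:E
               < (a / 2)%:E)%E)
    (n0 : n 0 = 0)
    (n'_sign : forall x y : R, 0 <= phi y * derive1 n x * y)
    (f_bound : forall t x y : R, t \in `[0, T] ->
                 `|f t x y| <= f t x y * n x + h t) :
  exists u : R -> R, dirichlet_solution T phi f u.
Proof.
have [phi_bij phi_c [g0 [phiK g0_c]]] := phi_homeo.
pose b := a / 2.
have b0 : 0 < b by rewrite divr_gt0.
have ba : b < a by rewrite /b; lra.
have Nb : - b <= b by lra.
(* Since [b < a], clipping keeps the argument of [g0] in a compact part of []- a, a[], so [g] is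
   continuous and bounded on the whole line. *)
pose g w := g0 (clip (- b) b w).
have clip_a w : clip (- b) b w \in `]- a, a[.
  have := clip_itv w Nb; rewrite !in_itv /= => /andP[? ?].
  by apply/andP; split; lra.
have phig w : phi (g w) = clip (- b) b w.
  have [_ _ surj] := phi_bij.
  by have [y _ yE] := surj _ (clip_a w); rewrite /g -yE phiK.
have gc : continuous g.
  move=> w; apply: (@cvg_within_comp _ _ _ (nbhs w) [set` `]- a, a[]
    (clip (- b) b) g0).
  - exact: clip_continuous.
  - by apply: filterE => v; exact: clip_a.
  - by move/subspace_continuousP : g0_c; apply; exact: clip_a.
have [M gM] : exists M, forall w, `|g w| <= M.
  have [M HM] := within_compact_bounded (@segment_compact R (- b) b)
    (continuous_subspaceT gc).
  exists M => w; have := HM _ (clip_itv w Nb).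
  by rewrite /g (clip_id (clip_itv w Nb)).
have clip_sgn w : w != 0 -> 0 < w * clip (- b) b w.
  rewrite neq_lt => /orP[w0|w0].
    by rewrite nmulr_rgt0// /clip gt_max oppr_lt0 b0 gt_min w0 orbT.
  by rewrite pmulr_rgt0// /clip lt_max lt_min b0 w0 orbT.
have clip_sq w : w != 0 -> 0 < clip (- b) b w ^+ 2.
  move=> /clip_sgn; rewrite exprn_even_gt0//=; apply: contraTneq => ->.
  by rewrite mulr0 ltxx.
have gsgn : (forall w, w != 0 -> 0 < w * g w) \/
            (forall w, w != 0 -> w * g w < 0).
  have g_neq0 w : w != 0 -> g w != 0.
    move=> /clip_sgn; apply: contraTneq => gw.
    by rewrite -phig gw phi0 mulr0 ltxx.
  (* After multiplication by a positive square, the sign of [w * g w] is that of [y * phi y] at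
     [y = g w]. A continuous injective [phi] is strictly monotone with [phi 0 = 0], so this sign is
     constant for nonzero [y]. *)
  have gE w : w * g w * clip (- b) b w ^+ 2 =
      (w * clip (- b) b w) * (g w * phi (g w)) by rewrite phig; ring.
  have : {within [set` `]-oo, +oo[], continuous phi}.
    exact: continuous_subspaceT.
  move=> /itv_continuous_inj_mono[|mono|mono].
  - by move=> x y _ _; exact: (can_inj phiK).
  - left=> w w0; rewrite -(pmulr_lgt0 _ (clip_sq w w0)) gE mulr_gt0 ?clip_sgn//.
    have := g_neq0 w w0; rewrite neq_lt => /orP[gw|gw].
      by rewrite nmulr_rgt0// -phi0 mono.
    by rewrite pmulr_rgt0// -[ltLHS]phi0 mono.
  - right=> w w0; rewrite -(pmulr_llt0 _ (clip_sq w w0)) gE pmulr_rlt0 ?clip_sgn//.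
    have := g_neq0 w w0; rewrite neq_lt => /orP[gw|gw].
      by rewrite nmulr_rlt0// -[ltLHS]phi0 mono.
    by rewrite pmulr_rlt0// -[ltRHS]phi0 mono.
have [X [W [X0 XT X' W']]] := dirichlet_system T_gt0 gc gM gsgn f_cont.
pose I : set R := [set` `[0, T]].
have g_eq0 w : g w = 0 -> w = 0.
  move=> gw; apply/eqP; apply: contraPT gw => w0; apply/eqP.
  case: gsgn => /(_ w w0); rewrite ltNge; apply: contraNneq => ->;
    by rewrite mulr0.
(* The sign condition at [y = g w] concerns [phi (g w)], the clipped momentum; it carries over to
   [w], which has the same sign. *)
have n'_sign_g w x : 0 <= w * (n^`()%classic x * g w).
  apply: (clip_mul_ge0 b0); rewrite -phig mulrA; exact: n'_sign.
(* As [h] is nonnegative, its integral is its norm, below [a / 2 = b]. Clipping is therefore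
   inactive along [W], and [phi] of the derivative of [X] is [W]. *)
have Wb t : I t -> `|W t| < b.
  move=> It; apply: le_lt_trans (momentum_bound T_gt0 X0 XT X' W' g_eq0 h_cont
    n_derivable n0 n'_sign_g f_bound It) _.
  rewrite -lte_fin /Rintegral fineK.
    rewrite (le_lt_trans _ h_L1)// le_eqVlt; apply/orP; left; apply/eqP.
    apply: eq_integral => s; rewrite inE /= => sI.
    by rewrite ger0_norm// h_ge0.
  apply: integrable_fin_num => //; apply: continuous_compact_integrable => //.
  exact: segment_compact.
have phigW t : I t -> phi (g (W t)) = W t.
  move=> It; rewrite phig clip_id// in_itv /= -ler_norml ltW//; exact: Wb.
have du t : I t -> derive_in I X t = g (W t).
  by move=> It; case: (derive_inE T_gt0 It (X' t It)).
have Xc : {within I, continuous X} := diff_quot_continuous X'.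
have Wc : {within I, continuous W} := diff_quot_continuous W'.
have gWc : {within I, continuous (fun t => g (W t))}.
  apply/subspace_continuousP => t It; apply: continuous_cvg; first exact: gc.
  by move/subspace_continuousP : Wc; exact.
have pdu t : I t -> diff_quot (phi \o derive_in I X) t @ within I t^' -->
    f t (X t) (derive_in I X t).
  move=> It; rewrite du//; apply: eq_diff_quot_cvg It (W' t It) => s Is /=.
  by rewrite du// phigW.
exists X; split => //=.
- split.
    by move=> t It; case: (derive_inE T_gt0 It (X' t It)).
  apply: subspace_eq_continuous gWc => t; rewrite inE => It.
  exact/esym/du.
- split.
    by move=> t It; case: (derive_inE T_gt0 It (pdu t It)).
  (* On [I] the derivative of [phi] of u' agrees with f(t, X, g(W)), continuous as a composition. *)
  apply: (@subspace_eq_continuous _ _ _ (fun t => f t (X t) (g (W t)))).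
    move=> t; rewrite inE => It.
    have [_ e] := derive_inE T_gt0 It (pdu t It).
    exact: etrans (congr1 (f t (X t)) (esym (du t It))) (esym e).
  apply/subspace_continuousP => t It.
  apply: (@cvg_within_comp _ _ _ (within I (nbhs t))
    [set p : R * R * R | p.1.1 \in `[0, T]]
    (fun s => (s, X s, g (W s))) (fun p => f p.1.1 p.1.2 p.2) (t, X t, g (W t))).
  + apply: cvg_pair_pt; first apply: cvg_pair_pt.
    * exact: cvg_within.
    * by move/subspace_continuousP : Xc; exact.
    * by move/subspace_continuousP : gWc; exact.
  + exact: withinT.
  + by move/subspace_continuousP : f_cont; exact.
- by move=> t It; case: (derive_inE T_gt0 It (pdu t It)).
Qed.
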